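(* Let problem (EP) be in the reduced canonical form described in the context. Then (EP) has the same optimal value as the SOCP problem $$\begin{aligned}(\mathrm{EP}_1)\quad \min\ &\sum_{i=1}^l(\delta_iy_i+e_ix_i)+\sum_{j=1}^{(n-l)/2}\zeta_jz_j+c_0\\ \text{s.t. }&\sum_{i=1}^l(\alpha_iy_i+b_ix_i)+\sum_{j=1}^{(n-l)/2}z_j+c=0,\\ &\tfrac12x_i^2-y_i\le0,\ i=1,\ldots,l,\quad x,y\in\mathbb R^l,\ z\in\mathbb R^{(n-l)/2},\end{aligned}$$ where $c_0=-\sum_{j=1}^{(n-l)/2}\frac12e_{l+2j}^2$. More specifically, if $(\mathrm{EP}_1)$ admits an optimal solution, then there exists an optimal solution $(\bar x,\bar y,\bar z)$ of $(\mathrm{EP}_1)$ with $\frac12\bar x_i^2=\bar y_i$, $i=1,\ldots,l$, such that the following hold. (a) An optimal solution (or, for any $\epsilon>0$, an $\epsilon$-optimal solution, with $M>0$ sufficiently large) $\tilde x$ of (EP) is given by $\tilde x_i=\bar x_i$ for $i=1,\ldots,l$, and for $j=1,\ldots,\frac{n-l}2$: $\tilde x_{l+2j}=1/M$ if $e_{l+2j}=0$ and $\bar z_j\ne0$, $\tilde x_{l+2j}=-e_{l+2j}$ otherwise, and $\tilde x_{l+2j-1}=\bar z_j/\tilde x_{l+2j}$ (with $\tilde x_{l+2j-1}$ an arbitrary real number when $\tilde x_{l+2j}=0$). (b) If (EP) is bounded from below, the optimal value of (EP) is not attained if and only if $e_{l+2j}=0$ and $\bar z_j\ne0$ for some $j$.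 In this case, for any $\epsilon>0$, the point $\tilde x$ above is, for $M>0$ sufficiently large, an $\epsilon$-optimal solution with $f(\tilde x)-v(\mathrm{EP})<\epsilon$. Furthermore, if $\zeta_i\ne\zeta_j$ for some $i\neq j$ in $\{1,\ldots,\frac{n-l}2\}$, then (EP) is unbounded from below.
   Context: Problem (EP) is $\min\{f(x)=\tfrac12x^TDx+e^Tx : h(x)=\tfrac12x^TAx+b^Tx+c=0,\ x\in\mathbb R^n\}$, with $A,D$ real symmetric, $b,e\in\mathbb R^n$, $c\in\mathbb R$. $v(\cdot)$ denotes the optimal value (infimum); a feasible point is $\epsilon$-optimal if its objective value exceeds the optimal value by at most $\epsilon$. Standing assumption: (EP) is feasible; the three conditions $A\succeq0$, $b\in\mathrm{Range}(A)$, $c=\frac12b^TA^+b$ ($A^+$ the Moore–Penrose pseudoinverse) do not all hold simultaneously; $A\ne0$; and the two-sided Slater condition holds: there exist $x',x''$ with $h(x')<0<h(x'')$. Reduced canonical form (the form of (EP) under the necessary conditions for boundedness): $n-l$ is even, $$A=\mathrm{diag}(\alpha_1,\ldots,\alpha_l,E_1,\ldots,E_{(n-l)/2}),\quad D=\mathrm{diag}(\delta_1,\ldots,\delta_l,E_1J(\zeta_1,2),\ldots,E_{(n-l)/2}J(\zeta_{(n-l)/2},2)),$$ with $\alpha_i,\delta_i,\zeta_j\in\mathbb R$, $E_j=\begin{pmatrix}0&1\\1&0\end{pmatrix}$, $E_jJ(\zeta_j,2)=\begin{pmatrix}0&\zeta_j\\ \zeta_j&1\end{pmatrix}$; moreover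 $e_{l+2j-1}=0$ for all $j=1,\ldots,\frac{n-l}2$ and $b_i=0$ for $i=l+1,\ldots,n$. *)

(* Defs.v *)
From HB Require Import structures.
From mathcomp Require Import all_boot all_order all_algebra.
From mathcomp Require Import boolp classical_sets reals constructive_ereal ereal.

Set Implicit Arguments.
Unset Strict Implicit.
Unset Printing Implicit Defensive.

Import Order.TTheory GRing.Theory Num.Theory.

Local Open Scope classical_set_scope.
Local Open Scope ring_scope.

Section Optimization.
Variables (R : realType) (T : Type).
Implicit Types (F : set T) (obj : T -> R) (x : T).

(* [-oo] if the problem is unbounded from below, [+oo] if it is infeasible. *)
Definition opt_value F obj : \bar R := ereal_inf [set (obj x)%:E | x in F].

Definition bounded_from_below F obj : Prop := has_lbound (obj @` F).

Definition optimal F obj x : Prop :=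
  F x /\ forall x', F x' -> obj x <= obj x'.

Definition attained F obj : Prop := exists x, optimal F obj x.

Definition eps_optimal F obj (eps : R) x : Prop :=
  F x /\ ((obj x)%:E <= opt_value F obj + eps%:E)%E.

End Optimization.

Section MoorePenrose.
Variable R : realType.

Definition is_pinv m n (A : 'M[R]_(m, n)) (X : 'M[R]_(n, m)) : Prop :=
  [/\ A *m X *m A = A,
      X *m A *m X = X,
      (A *m X)^T = A *m X &
      (X *m A)^T = X *m A].

(* The matrix characterized by [is_pinv], see [pinvP] and [is_pinv_unique]. *)
Definition pinv m n (A : 'M[R]_(m, n)) : 'M[R]_(n, m) :=
  xget 0 [set X | is_pinv A X].

Lemma gram_unit r n (B : 'M[R]_(r, n)) : row_free B -> B *m B^T \in unitmx.
Proof.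
move=> Bfree; rewrite -row_free_unit -kermx_eq0; apply/eqP/row_matrixP => i.
rewrite row0; set u := row i _.
have uBB : u *m (B *m B^T) = 0.
  by apply/sub_kermxP; exact: row_sub.
have : (u *m B) *m (u *m B)^T = 0 by rewrite trmx_mul !mulmxA -(mulmxA u) uBB mul0mx.
move=> /matrixP/(_ 0 0); rewrite !mxE => /eqP.
rewrite psumr_eq0; last by move=> j _; rewrite [X in _ * X]mxE -expr2 sqr_ge0.
move=> /allP uB0; apply: (row_free_inj Bfree); rewrite mul0mx.
apply/rowP => j; rewrite [RHS]mxE.
have := uB0 j; rewrite mem_index_enum => /(_ isT) /=.
by rewrite [X in _ * X]mxE -expr2 sqrf_eq0 => /eqP.
Qed.

Lemma is_pinv_exists m n (A : 'M[R]_(m, n)) : exists X, is_pinv A X.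
Proof.
have [r [L [B [Lfull Bfree <-]]]] : exists r (L : 'M[R]_(m, r)) (B : 'M_(r, n)),
    [/\ row_full L, row_free B & L *m B = A].
  exists (\rank A), (col_base A), (row_base A).
  by rewrite mulmx_base col_base_full row_base_free.
have BU : B *m B^T \in unitmx by exact: gram_unit.
have LU : L^T *m L \in unitmx.
  by have := @gram_unit _ _ L^T; rewrite trmxK /row_free mxrank_tr; apply.
set G := B *m B^T in BU; set K := L^T *m L in LU.
have GT : G^T = G by rewrite trmx_mul trmxK.
have KT : K^T = K by rewrite trmx_mul trmxK.
pose X := B^T *m invmx G *m invmx K *m L^T.
have AX : L *m B *m X = L *m invmx K *m L^T.
  by rewrite /X !mulmxA -(mulmxA L B) -/G mulmxK.
have XA : X *m (L *m B) = B^T *m invmx G *m B.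
  by rewrite /X !mulmxA -(mulmxA _ L^T L) -/K mulmxKV.
exists X; split.
- by rewrite AX !mulmxA -(mulmxA _ L^T L) -/K mulmxKV.
- by rewrite XA /X !mulmxA -(mulmxA _ B B^T) -/G mulmxKV.
- by rewrite AX !trmx_mul trmxK trmx_inv KT mulmxA.
- by rewrite XA !trmx_mul trmxK trmx_inv GT mulmxA.
Qed.

Lemma is_pinv_unique m n (A : 'M[R]_(m, n)) X Y :
  is_pinv A X -> is_pinv A Y -> X = Y.
Proof.
move=> [x1 x2 x3 x4] [y1 y2 y3 y4].
have AXY : A *m X = A *m Y.
  rewrite -x3 -y3 -[in LHS]y1 -[A *m Y *m A *m X]mulmxA trmx_mul x3 y3.
  by rewrite mulmxA x1.
have XAY : X *m A = Y *m A.
  rewrite -x4 -y4 -[in LHS]y1 -[A *m Y *m A]mulmxA mulmxA trmx_mul x4 y4.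
  by rewrite -mulmxA (mulmxA A) x1.
by rewrite -x2 XAY -mulmxA AXY mulmxA y2.
Qed.

Lemma pinvP m n (A : 'M[R]_(m, n)) : is_pinv A (pinv A).
Proof. exact: xgetPex (is_pinv_exists A). Qed.

End MoorePenrose.

Section EqualityConstrainedQuadratic.
Variables (R : realType) (n : nat).

Definition psd (A : 'M[R]_n) : Prop :=
  forall x : 'cV[R]_n, 0 <= (x^T *m A *m x) 0 0.

Definition quad (Q : 'M[R]_n) (q : 'cV[R]_n) (r : R) (x : 'cV[R]_n) : R :=
  2^-1 * (x^T *m Q *m x) 0 0 + (q^T *m x) 0 0 + r.

Record ep_data := EPData {
  epA : 'M[R]_n;
  epA_sym : epA^T = epA;
  epD : 'M[R]_n;
  epD_sym : epD^T = epD;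
  epb : 'cV[R]_n;
  epe : 'cV[R]_n;
  epc : R
}.

Variable P : ep_data.

Definition ep_obj : 'cV[R]_n -> R := quad (epD P) (epe P) 0.

Definition ep_con : 'cV[R]_n -> R := quad (epA P) (epb P) (epc P).

Definition ep_feas : set 'cV[R]_n := [set x | ep_con x = 0].

Definition standing_assumption : Prop :=
  [/\ exists x, ep_feas x,
      ~ [/\ psd (epA P),
            exists w : 'cV[R]_n, epb P = epA P *m w &
            epc P = 2^-1 * ((epb P)^T *m pinv (epA P) *m epb P) 0 0],
      epA P != 0 &
      exists x' x'', ep_con x' < 0 < ep_con x''].

End EqualityConstrainedQuadratic.

(* The dimension is n = l + 2m, written so that the library's block matrices
   [\mxdiag] and [\mxcol], here with m blocks of size 2, apply. *)
Notation rcf_dim l m := (l + \sum_(j < m) 2)%N.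

Section ReducedCanonicalForm.
Variables (R : realType) (l m : nat).

(* With indices from 1, [head_coord v i] is v_i for i <= l, [fst_coord v j] is
   v_(l+2j-1) and [snd_coord v j] is v_(l+2j) for j <= m. *)
Definition head_coord (v : 'cV[R]_(rcf_dim l m)) (i : 'I_l) : R :=
  usubmx v i 0.
Definition fst_coord (v : 'cV[R]_(rcf_dim l m)) (j : 'I_m) : R :=
  submxcol (dsubmx v) j 0 0.
Definition snd_coord (v : 'cV[R]_(rcf_dim l m)) (j : 'I_m) : R :=
  submxcol (dsubmx v) j 1 0.

(* The anti-diagonal matrix E and the upper Jordan block J(z, 2). *)
Definition flip2 : 'M[R]_2 := \matrix_(i, k) (i != k)%:R.
Definition jordan2 (z : R) : 'M[R]_2 := z%:M + delta_mx 0 1.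

Definition rcf_A (alpha : 'rV[R]_l) : 'M[R]_(rcf_dim l m) :=
  block_mx (diag_mx alpha) 0 0 (\mxdiag_(j < m) flip2).

Definition rcf_D (delta : 'rV[R]_l) (zeta : 'rV[R]_m) : 'M[R]_(rcf_dim l m) :=
  block_mx (diag_mx delta) 0 0 (\mxdiag_(j < m) (flip2 *m jordan2 (zeta 0 j))).

Definition reduced_canonical_form (alpha delta : 'rV[R]_l) (zeta : 'rV[R]_m)
    (P : ep_data R (rcf_dim l m)) : Prop :=
  [/\ epA P = rcf_A alpha,
      epD P = rcf_D delta zeta,
      forall j, fst_coord (epe P) j = 0 &
      dsubmx (epb P) = 0].

Definition socp_var : Type := ('cV[R]_l * 'cV[R]_l * 'cV[R]_m)%type.

Definition socp_c0 (P : ep_data R (rcf_dim l m)) : R :=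
  - \sum_(j < m) 2^-1 * snd_coord (epe P) j ^+ 2.

Definition socp_obj (delta : 'rV[R]_l) (zeta : 'rV[R]_m)
    (P : ep_data R (rcf_dim l m)) (w : socp_var) : R :=
  let: (x, y, z) := w in
  \sum_(i < l) (delta 0 i * y i 0 + head_coord (epe P) i * x i 0)
  + \sum_(j < m) zeta 0 j * z j 0 + socp_c0 P.

Definition socp_feas (alpha : 'rV[R]_l) (P : ep_data R (rcf_dim l m)) :
    set socp_var :=
  [set w : socp_var | let: (x, y, z) := w in
    \sum_(i < l) (alpha 0 i * y i 0 + head_coord (epb P) i * x i 0)
      + \sum_(j < m) z j 0 + epc P = 0
    /\ forall i, 2^-1 * x i 0 ^+ 2 - y i 0 <= 0].

(* e_(l+2j) = 0 and z_j <> 0: the term x_(l+2j)^2 / 2 of the objective has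
   infimum 0 but cannot vanish when x_(l+2j-1) x_(l+2j) = z_j. *)
Definition degenerate (P : ep_data R (rcf_dim l m)) (z : 'cV[R]_m) (j : 'I_m) :
    bool :=
  (snd_coord (epe P) j == 0) && (z j 0 != 0).

Definition rec_snd (P : ep_data R (rcf_dim l m)) (z : 'cV[R]_m) (M : R)
    (j : 'I_m) : R :=
  if degenerate P z j then M^-1 else - snd_coord (epe P) j.

(* [t j] is the arbitrary value of the coordinate l+2j-1 when the coordinate
   l+2j is zero. *)
Definition rec_fst (P : ep_data R (rcf_dim l m)) (z : 'cV[R]_m) (M : R)
    (t : 'I_m -> R) (j : 'I_m) : R :=
  if rec_snd P z M j == 0 then t j else z j 0 / rec_snd P z M j.

Definition recovered (P : ep_data R (rcf_dim l m)) (x : 'cV[R]_l)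
    (z : 'cV[R]_m) (M : R) (t : 'I_m -> R) : 'cV[R]_(rcf_dim l m) :=
  col_mx x (\mxcol_(j < m)
    \col_(k < 2) if k == 0 then rec_fst P z M t j else rec_snd P z M j).

End ReducedCanonicalForm.

(* Main.v *)
(* A feasible point of (EP) gives the feasible point of (EP_1) with y_i = x_i^2/2
   and z_j = x_(l+2j-1) x_(l+2j); the objective drops by the sum of
   (x_(l+2j) + e_(l+2j))^2/2, which is zero or arbitrarily small at the recovered
   points.  So everything reduces to tightening: replacing a feasible point of
   (EP_1) by one with y_i = x_i^2/2 and no larger objective.
   If m > 0, move each x_i to an end of the chord of the parabola at height y_i
   and absorb the change of the constraint in one z_j; the sign of the objective
   change, including the term from z_j, is chosen coordinatewise.
   If m = 0, then alpha_k <> 0 for some k.  A coordinate with alpha_i <> 0 moves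
   along the line that keeps alpha_i y_i + b_i x_i constant, and those with
   alpha_i = 0 are easy unless delta_i < 0 and b_i <> 0.  In that case solving the
   constraint for x_i makes the objective a quartic in x_k with negative leading
   coefficient, so it is unbounded from below on tight points. *)
Require Import Defs.
From mathcomp Require Import all_boot all_order all_algebra.
From mathcomp Require Import boolp classical_sets reals constructive_ereal ereal.
From mathcomp Require Import ring lra.

Set Implicit Arguments.
Unset Strict Implicit.
Unset Printing Implicit Defensive.

Import Order.TTheory GRing.Theory Num.Theory.

Local Open Scope classical_set_scope.
Local Open Scope ring_scope.

(** * Blocks of size 2, and the quadratic forms of [A] and [D] in coordinates *)

Lemma lift01 : lift ord0 ord0 = 1 :> 'I_2.
Proof. exact: val_inj. Qed.

Lemma dot2E (R : pzRingType) (a b : 'cV[R]_2) :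
  (a^T *m b) 0 0 = a 0 0 * b 0 0 + a 1 0 * b 1 0.
Proof. by rewrite mxE !big_ord_recl big_ord0 addr0 lift01 ![a^T _ _]mxE. Qed.

Lemma mul2E (R : pzRingType) (B : 'M[R]_2) (b : 'cV[R]_2) i :
  (B *m b) i 0 = B i 0 * b 0 0 + B i 1 * b 1 0.
Proof. by rewrite mxE !big_ord_recl big_ord0 addr0 lift01. Qed.

(** Swapping the rows moves the off-diagonal 1 of the Jordan block to the lower right corner; this
    entry is the source of the term [2^-1 * snd_coord v j ^+ 2] in the objective. *)
Lemma flip2_jordan2E (R : realType) (z : R) i k :
  (flip2 R *m jordan2 z) i k = (i != k)%:R * z + ((i == 1) && (k == 1))%:R.
Proof.
rewrite mxE !big_ord_recl big_ord0 addr0 lift01 !mxE.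
case: i => [[|[|[]]] // ?]; case: k => [[|[|[]]] // ?] /=;
  rewrite ?mulr1n ?mulr0n; ring.
Qed.

Section Coordinates.
Variables (R : realType) (l m : nat).
Implicit Types (v q : 'cV[R]_(rcf_dim l m)).

Lemma lin_coordE q v : (q^T *m v) 0 0 =
  \sum_(i < l) head_coord q i * head_coord v i +
  \sum_(j < m) (fst_coord q j * fst_coord v j + snd_coord q j * snd_coord v j).
Proof.
rewrite -[in LHS](vsubmxK q) -[in LHS](vsubmxK v) tr_col_mx mul_row_col mxE.
congr (_ + _).
  by rewrite mxE; apply: eq_bigr => i _; rewrite mxE.
have {1}<- : \mxcol_(j < m) submxcol (dsubmx q) j = dsubmx q := submxcolK _.
have {1}<- : \mxcol_(j < m) submxcol (dsubmx v) j = dsubmx v := submxcolK _.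
rewrite tr_mxcol mul_mxrow_mxcol summxE; apply: eq_bigr => j _.
exact: dot2E.
Qed.

Lemma blockdiag_mulE (d : 'rV[R]_l) (B : 'I_m -> 'M[R]_2) v :
  block_mx (diag_mx d) 0 0 (\mxdiag_(j < m) B j) *m v =
  col_mx (\col_i (d 0 i * head_coord v i))
         (\mxcol_(j < m) (B j *m submxcol (dsubmx v) j)).
Proof.
rewrite -[in LHS](vsubmxK v) mul_block_col !mul0mx addr0 add0r.
congr col_mx.
  by apply/colP => i; rewrite mul_diag_mx mxE [RHS]mxE.
have {1}<- : \mxcol_(j < m) submxcol (dsubmx v) j = dsubmx v := submxcolK _.
by rewrite mul_mxdiag_mxcol.
Qed.

Lemma head_coord_col (x : 'cV[R]_l) (u : 'cV[R]_(\sum_(j < m) 2)) i :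
  head_coord (col_mx x u) i = x i 0.
Proof. by rewrite /head_coord col_mxKu. Qed.

Lemma fst_coord_col (x : 'cV[R]_l) (u : 'I_m -> 'cV[R]_2) j :
  fst_coord (col_mx x (\mxcol_j u j)) j = u j 0 0.
Proof. by rewrite /fst_coord col_mxKd mxcolK. Qed.

Lemma snd_coord_col (x : 'cV[R]_l) (u : 'I_m -> 'cV[R]_2) j :
  snd_coord (col_mx x (\mxcol_j u j)) j = u j 1 0.
Proof. by rewrite /snd_coord col_mxKd mxcolK. Qed.

Lemma rcf_A_quadE (alpha : 'rV[R]_l) v :
  2^-1 * (v^T *m rcf_A m alpha *m v) 0 0 =
  \sum_(i < l) alpha 0 i * (2^-1 * head_coord v i ^+ 2) +
  \sum_(j < m) fst_coord v j * snd_coord v j.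
Proof.
rewrite -mulmxA blockdiag_mulE lin_coordE mulrDr !mulr_sumr.
congr (_ + _); apply: eq_bigr => i _.
  by rewrite head_coord_col mxE; ring.
rewrite fst_coord_col snd_coord_col !mul2E ![flip2 _ _ _]mxE /=.
by rewrite -/(fst_coord v i) -/(snd_coord v i); field.
Qed.

Lemma rcf_D_quadE (delta : 'rV[R]_l) (zeta : 'rV[R]_m) v :
  2^-1 * (v^T *m rcf_D delta zeta *m v) 0 0 =
  \sum_(i < l) delta 0 i * (2^-1 * head_coord v i ^+ 2) +
  \sum_(j < m) (zeta 0 j * (fst_coord v j * snd_coord v j)
                + 2^-1 * snd_coord v j ^+ 2).
Proof.
rewrite -mulmxA blockdiag_mulE lin_coordE mulrDr !mulr_sumr.
congr (_ + _); apply: eq_bigr => i _.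
  by rewrite head_coord_col mxE; ring.
rewrite fst_coord_col snd_coord_col !mul2E !flip2_jordan2E /=.
by rewrite -/(fst_coord v i) -/(snd_coord v i); field.
Qed.
End Coordinates.

(** * Moving points above the parabola onto it without raising the objective *)

Section Tightening.
Variable R : realType.

Lemma quartic_le0 (c4 c3 c2 c1 c0 : R) : c4 < 0 ->
  exists T, c4 * T ^+ 4 + c3 * T ^+ 3 + c2 * T ^+ 2 + c1 * T + c0 <= 0.
Proof.
move=> c4lt0; pose S := `|c3| + `|c2| + `|c1| + `|c0|.
have S0 : 0 <= S by rewrite !addr_ge0.
(* As [T >= 1], the lower powers are at most [T ^+ 3], so the quartic is at most
   [(c4 * T + S) * T ^+ 3]; this [T] makes the first factor equal to [c4]. *)
pose T := 1 + S / - c4; exists T.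
have T1 : 1 <= T by rewrite lerDl divr_ge0 // oppr_ge0 ltW.
have T0 : 0 <= T by apply: le_trans T1.
have cT : c4 * T + S <= 0.
  have -> : c4 * T + S = c4 by rewrite /T; field; rewrite lt_eqF.
  exact: ltW.
have le_T3 c k : (k <= 3)%N -> c * T ^+ k <= `|c| * T ^+ 3.
  move=> k3; apply: (le_trans (ler_norm _)).
  rewrite normrM [`|T ^+ k|]ger0_norm ?exprn_ge0 //.
  by rewrite ler_wpM2l // ler_weXn2l.
have := (le_T3 c3 3 isT, le_T3 c2 2 isT, (le_T3 c1 1 isT, le_T3 c0 0 isT)).
rewrite expr1 expr0 mulr1 => -[[h3 h2] [h1 h0]].
have : (c4 * T + S) * T ^+ 3 <= 0 by rewrite mulr_le0_ge0 // exprn_ge0.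
rewrite /S !mulrDl -mulrA -exprS; lra.
Qed.

(** On the chord at height [y] a linear function is least at an end; the sign of [k] tells which
    one. *)
Lemma parabola_endpoint (k x y : R) : 2^-1 * x ^+ 2 <= y ->
  exists2 x', 2^-1 * x' ^+ 2 = y & k * x' <= k * x.
Proof.
move=> xy; have y2 : x ^+ 2 <= 2 * y by lra.
have y0 : 0 <= 2 * y by apply: le_trans y2; exact: sqr_ge0.
have : `|x| <= Num.sqrt (2 * y) by rewrite -sqrtr_sqr ler_sqrt.
rewrite ler_norml => /andP[lb_x ub_x].
have sq : Num.sqrt (2 * y) ^+ 2 = 2 * y by rewrite sqr_sqrtr.
have [k0|k0] := lerP 0 k.
  exists (- Num.sqrt (2 * y)); first by rewrite sqrrN sq; lra.
  by rewrite ler_wpM2l.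
exists (Num.sqrt (2 * y)); first by rewrite sq; lra.
by rewrite ler_wnM2l // ltW.
Qed.

(* When [al != 0] the point (x, y) is moved along the line on which
   [al * y + be * x] is constant: it is not vertical, so it meets the parabola
   on both sides of the point. *)
Lemma tighten_coord (al be de ep x y : R) : 2^-1 * x ^+ 2 <= y ->
    (al = 0 -> de < 0 -> be = 0) ->
  exists x', al * (2^-1 * x' ^+ 2) + be * x' = al * y + be * x /\
             de * (2^-1 * x' ^+ 2) + ep * x' <= de * y + ep * x.
Proof.
move=> xy; have [-> deg|al0 _] := eqVneq al 0.
  have [de0|de0] := lerP 0 de.
    by exists x; rewrite !mul0r lerD2r ler_wpM2l.
  have [x' <- le_x'] := parabola_endpoint ep xy.
  by exists x'; rewrite deg // !mul0r lerD2l.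
(* The line is parametrized as [(x + al * t, y - be * t)]. It meets the parabola where
   [al ^+ 2 * (2^-1 * t ^+ 2) + B * t = s], and the objective changes by
   [(ep * al - de * be) * t]. *)
pose B := al * x + be; pose s := y - 2^-1 * x ^+ 2.
have s0 : 0 <= s by rewrite subr_ge0.
have [t [tE le_t]] : exists t, al ^+ 2 * (2^-1 * t ^+ 2) + B * t = s
                          /\ (ep * al - de * be) * t <= 0.
  have al2 : 0 < al ^+ 2 by rewrite exprn_even_gt0.
  have s'0 : 0 <= 2^-1 * B ^+ 2 + al ^+ 2 * s.
    by rewrite addr_ge0 // mulr_ge0 ?sqr_ge0 // invr_ge0.
  (* Completing the square with [w = al ^+ 2 * t + B] turns the equation for [t] into a chord
     problem in which [t = 0] is the inner point [B]. *)
  have [|w wE le_w] := @parabola_endpoint (ep * al - de * be) B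
                                       (2^-1 * B ^+ 2 + al ^+ 2 * s).
    by rewrite lerDl mulr_ge0 // ltW.
  exists ((w - B) / al ^+ 2); split; last first.
    by rewrite mulrA pmulr_lle0 ?invr_gt0 // mulrBr subr_le0; exact: le_w.
  have -> : s = (2^-1 * w ^+ 2 - 2^-1 * B ^+ 2) / al ^+ 2.
    by rewrite wE; field.
  by field.
have xE : 2^-1 * (x + al * t) ^+ 2 = y - be * t.
  by move: tE; rewrite /B /s => tE; lra.
exists (x + al * t); rewrite xE; split; first ring.
by lra.
Qed.

Lemma tighten_sum l (alpha b delta e x y : 'I_l -> R) k : alpha k != 0 ->
    (forall i, 2^-1 * x i ^+ 2 <= y i) ->
  exists x' : 'I_l -> R,
    \sum_i (alpha i * (2^-1 * x' i ^+ 2) + b i * x' i) =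
      \sum_i (alpha i * y i + b i * x i) /\
    \sum_i (delta i * (2^-1 * x' i ^+ 2) + e i * x' i) <=
      \sum_i (delta i * y i + e i * x i).
Proof.
move=> ak xy.
have [good|] := pselect (forall i, alpha i = 0 -> delta i < 0 -> b i = 0).
  have [x' x'E] := choice (fun i => tighten_coord (e i) (xy i) (good i)).
  exists x'; split; first by apply: eq_bigr => i _; have [] := x'E i.
  by apply: ler_sum => i _; have [] := x'E i.
move=> /existsNP[i /not_implyP[ai /not_implyP[di /eqP bi]]].
set K := \sum_i (alpha i * y i + _); set N := \sum_i (delta i * y i + _).
have ki : k != i by apply: contra ak => /eqP ->; rewrite ai.
(* Only coordinates [i] and [k] are kept nonzero. Since [alpha i = 0], the constraint is linear in
   coordinate [i], and [X Y] solves it when coordinate [k] is [Y]. *)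
pose X Y := (K - alpha k * (2^-1 * Y ^+ 2) - b k * Y) / b i.
pose pt Y j := if j == i then X Y else if j == k then Y else 0.
have ptE p q Y : \sum_j (p j * (2^-1 * pt Y j ^+ 2) + q j * pt Y j) =
    p i * (2^-1 * X Y ^+ 2) + q i * X Y + (p k * (2^-1 * Y ^+ 2) + q k * Y).
  rewrite (bigD1 i) //= (bigD1 k) //= big1 => [|j /andP[ji jk]].
    by rewrite /pt eqxx (negPf ki) eqxx addr0.
  by rewrite /pt (negPf ji) (negPf jk) expr0n /= !mulr0 addr0.
pose a := - (alpha k / (2 * b i)); pose c := - (b k / b i); pose d := K / b i.
have XE Y : X Y = a * Y ^+ 2 + c * Y + d by rewrite /X /a /c /d; field.
(* These are the coefficients of the objective at [pt Y] minus its target [N]; the leading one is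
   negative because [delta i < 0] and [a != 0]. *)
have [|Y YE] := @quartic_le0 (2^-1 * delta i * a ^+ 2) (delta i * a * c)
   (2^-1 * delta i * (2 * a * d + c ^+ 2) + e i * a + 2^-1 * delta k)
   (delta i * c * d + e i * c + e k) (2^-1 * delta i * d ^+ 2 + e i * d - N).
  rewrite pmulr_llt0 ?pmulr_rlt0 ?invr_gt0 //.
  by rewrite exprn_even_gt0 //= oppr_eq0 mulf_neq0 // invr_eq0 mulf_neq0.
exists (pt Y); rewrite !ptE ai mul0r add0r; split.
  by rewrite /X; field.
rewrite XE -subr_le0; apply: le_trans YE; rewrite le_eqVlt; apply/orP; left.
by apply/eqP; field.
Qed.

Lemma tighten_sum_free l m (alpha b delta e x y : 'I_l -> R)
    (zeta z : 'I_m -> R) (j0 : 'I_m) :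
    (forall i, 2^-1 * x i ^+ 2 <= y i) ->
  exists (x' : 'I_l -> R) (z' : 'I_m -> R),
    \sum_i (alpha i * (2^-1 * x' i ^+ 2) + b i * x' i) + \sum_j z' j =
      \sum_i (alpha i * y i + b i * x i) + \sum_j z j /\
    \sum_i (delta i * (2^-1 * x' i ^+ 2) + e i * x' i)
        + \sum_j zeta j * z' j <=
      \sum_i (delta i * y i + e i * x i) + \sum_j zeta j * z j.
Proof.
move=> xy.
(* [e i - zeta j0 * b i] is the reduced cost of [x i]: a unit increase of [x i] adds [b i] to the
   constraint, which lowering [z j0] by [b i] offsets. *)
have [x' x'E] := choice (fun i =>
  let: ex_intro2 x' p q := parabola_endpoint (e i - zeta j0 * b i) (xy i) in
  ex_intro (fun x' => _ /\ _) x' (conj p q)).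
pose D := \sum_i b i * (x' i - x i).
pose z' j := z j - (if j == j0 then D else 0).
have zE (c : 'I_m -> R) : \sum_j c j * z' j = \sum_j c j * z j - c j0 * D.
  under eq_bigr do rewrite mulrBr.
  rewrite sumrB; congr (_ - _); rewrite (bigD1 j0) //= eqxx big1 ?addr0 //.
  by move=> j /negPf ->; rewrite mulr0.
exists x', z'; split.
  have := zE (fun=> 1); rewrite mul1r.
  under eq_bigr do rewrite mul1r.
  under [X in _ = X - _]eq_bigr do rewrite mul1r.
  suff -> : \sum_i (alpha i * (2^-1 * x' i ^+ 2) + b i * x' i) =
            \sum_i (alpha i * y i + b i * x i) + D by move=> ->; ring.
  rewrite /D -big_split; apply: eq_bigr => i _ /=.
  by have [-> _] := x'E i; ring.
rewrite zE -subr_ge0.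
suff : 0 <= \sum_i (delta i * y i + e i * x i) + zeta j0 * D -
            \sum_i (delta i * (2^-1 * x' i ^+ 2) + e i * x' i) by lra.
rewrite /D mulr_sumr -big_split -sumrB sumr_ge0 //= => i _.
by have [-> h] := x'E i; lra.
Qed.
End Tightening.

Lemma optimal_opt_value (R : realType) T (G : set T) (g : T -> R) w :
  optimal G g w -> opt_value G g = (g w)%:E.
Proof.
move=> [Gw le_w]; apply/eqP; rewrite eq_le; apply/andP; split.
  by apply: ereal_inf_lbound; exists w.
by apply: le_ereal_inf_tmp => _ [w' Gw' <-]; rewrite lee_fin le_w.
Qed.

(** * The correspondence between points of (EP) and tight points of (EP_1) *)

Section CanonicalForm.
Variables (R : realType) (l m : nat).
Variables (alpha delta : 'rV[R]_l) (zeta : 'rV[R]_m).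
Variable P : ep_data R (rcf_dim l m).
Hypothesis hcan : reduced_canonical_form alpha delta zeta P.
Implicit Types (x y : 'cV[R]_l) (z : 'cV[R]_m) (v : 'cV[R]_(rcf_dim l m)).

Let F := ep_feas P.
Let f := ep_obj P.
Let F1 := socp_feas alpha P.
Let f1 := socp_obj delta zeta P.

Definition half_sq x : 'cV[R]_l := \col_i (2^-1 * x i 0 ^+ 2).

Definition socp_point v : socp_var R l m :=
  (usubmx v, half_sq (usubmx v), \col_j (fst_coord v j * snd_coord v j)).

Lemma ep_conE v : ep_con P v =
  \sum_(i < l) (alpha 0 i * (2^-1 * head_coord v i ^+ 2)
                + head_coord (epb P) i * head_coord v i)
  + \sum_(j < m) fst_coord v j * snd_coord v j + epc P.
Proof.
case: hcan => AE _ _ b0; rewrite /ep_con /quad AE rcf_A_quadE lin_coordE.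
rewrite [X in _ + (_ + X)]big1 ?addr0 => [|j _].
  by rewrite big_split /=; congr (_ + _); rewrite addrAC.
by rewrite /fst_coord /snd_coord b0 !mxE !mul0r addr0.
Qed.

(** Completing the square in each [snd_coord v j] leaves the constants that add up to [socp_c0]. *)
Lemma ep_objE v : f v = f1 (socp_point v) +
  \sum_(j < m) 2^-1 * (snd_coord v j + snd_coord (epe P) j) ^+ 2.
Proof.
case: hcan => _ DE e0 _; rewrite /f /ep_obj /quad DE rcf_D_quadE lin_coordE.
rewrite /f1 /= /socp_c0 addr0 addrACA -big_split -!addrA; congr (_ + _).
  by apply: eq_bigr => i _; rewrite mxE.
rewrite -sumrN -!big_split; apply: eq_bigr => j _ /=.
by rewrite e0 mxE; field.
Qed.

Lemma ep_feasE v : F v <-> F1 (socp_point v).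
Proof.
rewrite /F /F1 /ep_feas /socp_feas /= ep_conE.
under [X in _ <-> X + _ + _ = _ /\ _]eq_bigr do rewrite mxE.
under [X in _ <-> _ + X + _ = _ /\ _]eq_bigr do rewrite mxE.
by split=> [-> | []] //; split=> // i; rewrite [half_sq _ _ _]mxE subrr.
Qed.

Lemma socp_point_le v : f1 (socp_point v) <= f v.
Proof.
rewrite ep_objE lerDl sumr_ge0 // => j _.
by rewrite mulr_ge0 ?sqr_ge0 ?invr_ge0.
Qed.

Lemma socp_point_recovered x z M t : 0 < M ->
  socp_point (recovered P x z M t) = (x, half_sq x, z).
Proof.
move=> M0; rewrite /socp_point /recovered col_mxKu; congr (_, _, _).
apply/colP => j; rewrite mxE fst_coord_col snd_coord_col !mxE /= /rec_fst.
case: eqP => [w0|/eqP w0]; last by rewrite divfK.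
(* A zero second coordinate cannot be [M^-1], so the block is nondegenerate with
   [snd_coord (epe P) j = 0]; hence [z j 0 = 0], and the value of [t j] is immaterial. *)
rewrite w0 mulr0; move: w0; rewrite /rec_snd /degenerate.
case: ifPn => [_ /eqP|]; first by rewrite invr_eq0 gt_eqF.
rewrite negb_and negbK => /orP[/negPf e0 /eqP|/eqP-> //].
by rewrite oppr_eq0 e0.
Qed.

Lemma recovered_feas x z M t : 0 < M ->
  F1 (x, half_sq x, z) -> F (recovered P x z M t).
Proof. by move=> M0 wF; apply/ep_feasE; rewrite socp_point_recovered. Qed.

Lemma ep_obj_recovered x z M t : 0 < M ->
  f (recovered P x z M t) = f1 (x, half_sq x, z) +
    \sum_(j < m) (if degenerate P z j then 2^-1 * M^-1 ^+ 2 else 0).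
Proof.
move=> M0; rewrite ep_objE socp_point_recovered //; congr (_ + _).
apply: eq_bigr => j _; rewrite snd_coord_col !mxE /= /rec_snd.
by case: ifP => [/andP[/eqP-> _]|_]; rewrite ?addr0 // addNr expr0n /= mulr0.
Qed.

Lemma recovered_eps x z eps : 0 < eps ->
  exists2 M0, 0 < M0 & forall M t, M0 <= M ->
    f (recovered P x z M t) < f1 (x, half_sq x, z) + eps.
Proof.
(* [M >= 1] bounds each degenerate term by [M^-1], and [M > m%:R / eps] keeps the sum of [m] such
   terms below [eps]. *)
move=> eps0; pose M0 := 1 + m%:R / eps.
have M01 : 1 <= M0 by rewrite lerDl divr_ge0 // ltW.
exists M0; first exact: lt_le_trans M01.
move=> M t leM; have M1 : 1 <= M by apply: le_trans leM.
have Mgt0 : 0 < M by apply: lt_le_trans M1.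
rewrite ep_obj_recovered // ltrD2l.
apply: (@le_lt_trans _ _ (\sum_(j < m) M^-1)).
  apply: ler_sum => j _; case: ifP => _; last by rewrite invr_ge0 ltW.
  have : 0 < M^-1 <= 1 by rewrite invr_gt0 Mgt0 invf_le1.
  by move=> /andP[? ?]; nra.
rewrite sumr_const card_ord -[ltLHS]mulr_natl.
rewrite ltr_pdivrMr // mulrC -ltr_pdivrMr //.
by rewrite (lt_le_trans _ leM) // ltrDr.
Qed.

Lemma socp_tighten x y z : standing_assumption P -> F1 (x, y, z) ->
  exists x' z', F1 (x', half_sq x', z') /\
    f1 (x', half_sq x', z') <= f1 (x, y, z).
Proof.
move=> [_ _ A0 _] [hc xy].
have {}xy i : 2^-1 * x i 0 ^+ 2 <= y i 0 by rewrite -subr_le0.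
suff [x' [z' [cE fE]]] : exists (x' : 'I_l -> R) (z' : 'I_m -> R),
    \sum_i (alpha 0 i * (2^-1 * x' i ^+ 2) + head_coord (epb P) i * x' i)
      + \sum_j z' j =
    \sum_i (alpha 0 i * y i 0 + head_coord (epb P) i * x i 0)
      + \sum_j z j 0 /\
    \sum_i (delta 0 i * (2^-1 * x' i ^+ 2) + head_coord (epe P) i * x' i)
      + \sum_j zeta 0 j * z' j <=
    \sum_i (delta 0 i * y i 0 + head_coord (epe P) i * x i 0)
      + \sum_j zeta 0 j * z j 0.
  exists (\col_i x' i), (\col_j z' j); split.
    split=> [|i]; last by rewrite !mxE subrr.
    rewrite -[RHS]hc -cE; congr (_ + _ + _); apply: eq_bigr => i _;
      by rewrite !mxE.
  rewrite /f1 /= lerD2r; apply: le_trans fE; rewrite le_eqVlt; apply/orP; left.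
  by apply/eqP; congr (_ + _); apply: eq_bigr => i _; rewrite !mxE.
have [[j0 _]|noj] := pselect (exists j : 'I_m, True).
  exact: tighten_sum_free.
have m0 (j : 'I_m) : False by apply: noj; exists j.
(* Without blocks of size 2, [A] is just [diag_mx alpha], so [A0] forces a nonzero entry. *)
have [k ak] : exists k, alpha 0 k != 0.
  apply/existsP; apply: contra_neqT A0 => /existsPn a0.
  have alpha0 : alpha = 0.
    by apply/rowP => i; rewrite mxE; apply/eqP; have := a0 i; rewrite negbK.
  have flips0 : \mxdiag_(j < m) flip2 R = 0.
    by apply/matrixP => i; case: (m0 (tagnat.sig1 i)).
  have [-> _ _ _] := hcan.
  by rewrite /rcf_A alpha0 flips0 [diag_mx _]raddf0 block_mx0.
have [x' [cE fE]] := tighten_sum (head_coord (epb P)) (delta 0)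
  (head_coord (epe P)) ak xy.
by exists x', (z^~ 0); rewrite cE lerD2r.
Qed.

(** A value of (EP_1) is tightened and then approached by recovered points; the slack [eps] is
    needed because degenerate blocks may prevent equality. *)
Lemma socp_opt_value : standing_assumption P -> opt_value F f = opt_value F1 f1.
Proof.
move=> hP; apply/eqP; rewrite eq_le; apply/andP; split.
  apply: le_ereal_inf_tmp => _ [[[x y] z] wF <-].
  have [x' [z' [wF' /= le_w]]] := socp_tighten hP wF.
  apply/lee_addgt0Pr => eps eps0; apply: ge_ereal_inf.
  have [M M0 /(_ M (fun=> 0) (lexx _)) ltM] := recovered_eps x' z' eps0.
  exists (f (recovered P x' z' M (fun=> 0)))%:E.
    by exists (recovered P x' z' M (fun=> 0)) => //; exact: recovered_feas.
  by rewrite -EFinD lee_fin (le_trans (ltW ltM)) // lerD2r.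
apply: le_ereal_inf_tmp => _ [v /ep_feasE vF <-]; apply: ge_ereal_inf.
exists (f1 (socp_point v))%:E; first by exists (socp_point v).
by rewrite lee_fin socp_point_le.
Qed.

(** As the optimal values agree, the sum of squares separating [f v] from [f1 (socp_point v)] must
    vanish. *)
Lemma ep_optimal_socp_point v : standing_assumption P -> optimal F f v ->
  optimal F1 f1 (socp_point v) /\
  forall j, snd_coord v j = - snd_coord (epe P) j.
Proof.
move=> hP vopt; have [vF _] := vopt.
have wF : F1 (socp_point v) by exact/ep_feasE.
have le_f1 w : F1 w -> f v <= f1 w.
  move=> w1; rewrite -lee_fin -(optimal_opt_value vopt) socp_opt_value //.
  by apply: ereal_inf_lbound; exists w.
split; first by split=> // w w1; exact: le_trans (socp_point_le v) (le_f1 w w1).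
have sq_ge0 j : true ->
    0 <= 2^-1 * (snd_coord v j + snd_coord (epe P) j) ^+ 2.
  by rewrite mulr_ge0 ?sqr_ge0 ?invr_ge0.
have : \sum_(j < m) 2^-1 * (snd_coord v j + snd_coord (epe P) j) ^+ 2 = 0.
  apply/eqP; rewrite eq_le sumr_ge0 // andbT.
  by have := le_f1 _ wF; rewrite ep_objE gerDl.
move=> /psumr_eq0P e0 j; apply/eqP; rewrite -addr_eq0 -(sqrf_eq0 (_ + _)).
by have /eqP := e0 sq_ge0 j isT; rewrite mulf_eq0 invr_eq0 pnatr_eq0.
Qed.

Lemma socp_unbounded i j : standing_assumption P ->
  i != j -> zeta 0 i != zeta 0 j -> ~ bounded_from_below F f.
Proof.
move=> hP ij zij [N lbN].
have [[v0 /ep_feasE]] := hP; case: (socp_point v0) => -[x y] z.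
move=> wF _ _ _.
(* Shifting [z i] by [T] and [z j] by [- T] preserves the constraint and changes the objective by
   [(zeta 0 i - zeta 0 j) * T]. The target [N - 2] leaves room for the error 1 of the recovered
   point below [N]. *)
pose T := (f1 (x, y, z) - N + 2) / (zeta 0 j - zeta 0 i).
pose z' : 'cV[R]_m := \col_k (z k 0 + (if k == i then T else 0)
                                   - (if k == j then T else 0)).
have zE (c : 'I_m -> R) :
    \sum_k c k * z' k 0 = \sum_k c k * z k 0 + (c i - c j) * T.
  under eq_bigr do rewrite mxE mulrBr mulrDr.
  rewrite sumrB big_split /= -addrA mulrBl; congr (_ + (_ - _)).
    by rewrite (bigD1 i) //= eqxx big1 ?addr0 // => k /negPf->; rewrite mulr0.
  by rewrite (bigD1 j) //= eqxx big1 ?addr0 // => k /negPf->; rewrite mulr0.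
have wF' : F1 (x, y, z').
  case: wF => hc xy; split=> //; rewrite -[RHS]hc; congr (_ + _ + _).
  have := zE (fun=> 1); rewrite subrr mul0r addr0.
  by under eq_bigr do rewrite mul1r; under [RHS]eq_bigr do rewrite mul1r.
have fE : f1 (x, y, z') = N - 2.
  have -> : f1 (x, y, z') = f1 (x, y, z) + (zeta 0 i - zeta 0 j) * T.
    by rewrite /f1 /= zE; ring.
  by rewrite /T; field; rewrite subr_eq0 eq_sym.
have [x1 [z1 [w1F]]] := socp_tighten hP wF'; rewrite -/f1 fE => le1.
have [M M0 /(_ M (fun=> 0) (lexx _)) ltM] := recovered_eps x1 z1 ltr01.
have : N <= f (recovered P x1 z1 M (fun=> 0)).
  apply: lbN; exists (recovered P x1 z1 M (fun=> 0)) => //.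
  exact: recovered_feas.
by rewrite -/f1 in ltM; lra.
Qed.

End CanonicalForm.

Theorem theorem11 (R : realType) (l m : nat)
    (alpha delta : 'rV[R]_l) (zeta : 'rV[R]_m)
    (P : ep_data R (rcf_dim l m))
    (hP : standing_assumption P)
    (hcan : reduced_canonical_form alpha delta zeta P) :
  let F := ep_feas P in
  let f := ep_obj P in
  let F1 := socp_feas alpha P in
  let f1 := socp_obj delta zeta P in
  [/\ (* (EP) and (EP_1) have the same optimal value *)
      opt_value F f = opt_value F1 f1,
      attained F1 f1 ->
      exists (x y : 'cV[R]_l) (z : 'cV[R]_m),
        [/\ optimal F1 f1 (x, y, z),
            forall i, 2^-1 * x i 0 ^+ 2 = y i 0,
            (* (a) *)
            ((forall j, ~~ degenerate P z j) ->
              forall (M : R) (t : 'I_m -> R), 0 < M ->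
                optimal F f (recovered P x z M t)) /\
            (forall eps : R, 0 < eps ->
              exists2 M0 : R, 0 < M0 &
                forall (M : R) (t : 'I_m -> R), M0 <= M ->
                  eps_optimal F f eps (recovered P x z M t)) &
            (* (b) *)
            bounded_from_below F f ->
              (~ attained F f <-> exists j, degenerate P z j) /\
              (~ attained F f ->
                forall eps : R, 0 < eps ->
                  exists2 M0 : R, 0 < M0 &
                    forall (M : R) (t : 'I_m -> R), M0 <= M ->
                      eps_optimal F f eps (recovered P x z M t) /\
                      ((f (recovered P x z M t))%:E - opt_value F f
                         < eps%:E)%E)] &
      (* unboundedness *)
      (exists i j : 'I_m, i != j /\ zeta 0 i != zeta 0 j) ->
        ~ bounded_from_below F f].
Proof.
move=> F f F1 f1; have optE := socp_opt_value hcan hP.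
split=> [//|[[[x0 y0] z0] wopt0]|[i [j [ij zij]]]]; last first.
  exact: (socp_unbounded hcan hP ij zij).
have tight_opt : exists x z, optimal F1 f1 (x, half_sq x, z).
  have [w0F w0min] := wopt0; have [x [z [wF le_w]]] := socp_tighten hcan hP w0F.
  by exists x, z; split=> // w w1; exact: le_trans le_w (w0min w w1).
(* A nondegenerate optimum is chosen whenever there is one; this is what makes
   degeneracy equivalent to non-attainment in (b). *)
have [x [z [wopt degN]]] : exists x z, optimal F1 f1 (x, half_sq x, z) /\
    ((exists j, degenerate P z j) -> forall x' z',
      optimal F1 f1 (x', half_sq x', z') -> exists j, degenerate P z' j).
  have [[x [z [wopt ndeg]]]|nex] := pselect (exists x z,
      optimal F1 f1 (x, half_sq x, z) /\ forall j, ~~ degenerate P z j).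
    by exists x, z; split=> // -[j]; rewrite (negPf (ndeg j)).
  have [x [z wopt]] := tight_opt; exists x, z; split=> // _ x' z' wopt'.
  apply: contrapT => nodeg; apply: nex; exists x', z'; split=> // j.
  by apply/negP => dj; apply: nodeg; exists j.
have [wF _] := wopt.
have optF : opt_value F f = (f1 (x, half_sq x, z))%:E.
  by rewrite optE (optimal_opt_value wopt).
have ndeg_opt : (forall j, ~~ degenerate P z j) -> forall M t, 0 < M ->
    optimal F f (recovered P x z M t).
  move=> ndeg M t M0; split; first exact: (recovered_feas hcan t M0 wF).
  move=> v vF; rewrite [leLHS](ep_obj_recovered hcan x z t M0).
  rewrite big1 ?addr0 => [|j _].
    by rewrite -lee_fin -optF; apply: ereal_inf_lbound; exists v.
  by rewrite (negPf (ndeg j)).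
have eps_opt eps : 0 < eps -> exists2 M0 : R, 0 < M0 &
    forall (M : R) (t : 'I_m -> R), M0 <= M ->
      eps_optimal F f eps (recovered P x z M t) /\
      ((f (recovered P x z M t))%:E - opt_value F f < eps%:E)%E.
  move=> eps0; have [M0 M0gt0 ltM] := recovered_eps hcan x z eps0.
  exists M0 => // M t leM.
  rewrite /eps_optimal optF -EFinD -EFinB lee_fin lte_fin.
  split; last by rewrite ltrBlDl; exact: ltM.
  split; last by rewrite ltW //; exact: ltM.
  exact: (recovered_feas hcan t (lt_le_trans M0gt0 leM) wF).
exists x, (half_sq x), z; split=> //; first by move=> i; rewrite mxE.
  split=> // eps /eps_opt[M0 M0gt0 hM]; exists M0 => // M t leM.
  by have [] := hM M t leM.
move=> _; split=> [|_ //]; split=> [nattF|exdeg [v vopt]].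
  apply: contrapT => nodeg; apply: nattF; exists (recovered P x z 1 (fun=> 0)).
  by apply: ndeg_opt => // j; apply/negP => dj; apply: nodeg; exists j.
(* An optimal [v] yields a tight optimum of (EP_1), which has a degenerate block by [degN]. There
   [snd_coord v j] is zero by [vE], so the product defining its [z] entry vanishes, contrary to
   degeneracy. *)
have [wvopt vE] := ep_optimal_socp_point hcan hP vopt.
have [j /andP[/eqP ej]] := degN exdeg _ _ wvopt.
by rewrite mxE vE ej oppr0 mulr0 eqxx.
Qed.
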